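(* Let $A$ be an integral domain (commutative with unit) and let $T$ be the theory of algebraically closed fields in the language $\langle +,-,\times,0,1\rangle$. The following are equivalent: (1) $A$ is an algebraically closed field; (2) for every $n\in\mathbb N$ and every finitely generated ideal $I$ of $A[X_1,\dots,X_n]$, $\mathscr I(\mathscr Z_A(I))=\sqrt I$; (3) for every $n\in\mathbb N$ and every finitely generated ideal $I$ of $A[X_1,\dots,X_n]$, $\mathscr I(\mathscr Z_A(I))=\sqrt[T]{I}$.
   Context: $\mathscr Z_A(I)=\{\bar a\in A^n: P(\bar a)=0 \text{ for all } P\in I\}$; for $S\subseteq A^n$, $\mathscr I(S)=\{P\in A[X_1,\dots,X_n]:P(\bar a)=0\text{ for all }\bar a\in S\}$; $\sqrt I$ is the usual radical of $I$. The $T$-radical $\sqrt[T]{I}$ is the intersection of all ideals $J$ of $A[X_1,\dots,X_n]$ with $I\subseteq J$, $A[X_1,\dots,X_n]/J$ a model of $T_\forall$ (the universal consequences of $T$, i.e. an integral domain), and $J\cap A=(0)$ (where $A$ is identified with the constant polynomials). *)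

(* Defs.v *)
From HB Require Import structures.
From mathcomp Require Import all_boot all_order all_algebra.
From mathcomp Require Import mpoly.
Set Implicit Arguments. Unset Strict Implicit. Unset Printing Implicit Defensive.
Import GRing.Theory.
Local Open Scope ring_scope.

Definition mpset (A : idomainType) (n : nat) := {mpoly A[n]} -> Prop.

Definition gen_ideal (A : idomainType) (n : nat) (s : seq {mpoly A[n]}) : mpset A n :=
  fun p => exists c : 'I_(size s) -> {mpoly A[n]},
    p = \sum_(i < size s) c i * s`_i.

Definition is_ideal (A : idomainType) (n : nat) (J : mpset A n) : Prop :=
  [/\ J 0, (forall p q, J p -> J q -> J (p + q)) & (forall p q, J q -> J (p * q))].

Definition zeroset (A : idomainType) (n : nat) (I : mpset A n) : ('I_n -> A) -> Prop :=
  fun a => forall P, I P -> P.@[a] = 0.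

Definition vanishing_ideal (A : idomainType) (n : nat) (S : ('I_n -> A) -> Prop)
  : mpset A n := fun P => forall a, S a -> P.@[a] = 0.

Definition radical (A : idomainType) (n : nat) (I : mpset A n) : mpset A n :=
  fun P => exists k : nat, I (P ^+ k).

(* A[X]/J is an integral domain (a model of T_forall, T = ACF):
   J is proper and ab in J implies a in J or b in J. *)
Definition quotient_is_domain (A : idomainType) (n : nat) (J : mpset A n) : Prop :=
  ~ J 1 /\ (forall p q, J (p * q) -> J p \/ J q).

Definition T_radical (A : idomainType) (n : nat) (I : mpset A n) : mpset A n :=
  fun P => forall J : mpset A n, is_ideal J -> (forall Q, I Q -> J Q) ->
    quotient_is_domain J -> (forall c : A, J c%:MP -> c = 0) -> J P.

Definition is_field (A : idomainType) : Prop :=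
  forall x : A, x != 0 -> x \is a GRing.unit.

Definition alg_closed (A : idomainType) : Prop :=
  forall p : {poly A}, (1 < size p)%N -> exists x, root p x.

(* Main.v *)
Require Import Defs.
From HB Require Import structures.
From mathcomp Require Import all_boot all_order all_algebra.
From mathcomp Require Import mpoly.
From mathcomp Require boolp classical_sets.
Set Implicit Arguments. Unset Strict Implicit. Unset Printing Implicit Defensive.
Import GRing.Theory.
Local Open Scope ring_scope.

(** The Nullstellensatz over an algebraically closed field [A] is proved for
    prime ideals, one variable at a time.  Let [P] be a prime ideal of [B[Y]]
    and [b] outside [P].  There is a single element [c] of [B] outside [P] such
    that every morphism [B -> A] which kills [P] on [B] but not [c] extends, by a
    suitable value of [Y], to a morphism that kills [P] but not [b].  Iterating
    this separates any polynomial outside a prime ideal of [A[X_1, .., X_n]] from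
    that ideal by a point of [A^n].  A polynomial outside the radical of [I] is
    outside some prime ideal containing [I], which gives (1) => (2); (1) => (3)
    follows since kernels of evaluations are prime ideals meeting [A] in [0].

    Conversely, if a nonconstant [p] in [A[X]] has no root, then (2) puts [1] in
    the ideal [(p)], which is absurd for degree reasons, and (3) says that no
    prime ideal contains [p] and meets [A] in [0], whereas an ideal containing
    [p] and maximal among those avoiding the nonzero constants is one. *)

(** * Ideals, and primes avoiding a multiplicative set *)

Section Ideals.

Variable R : comNzRingType.
Implicit Types (J : R -> Prop) (x y : R).

Definition ideal J :=
  [/\ J 0, (forall x y, J x -> J y -> J (x + y)) & (forall x y, J y -> J (x * y))].

Definition prime_ideal J :=
  [/\ ideal J, ~ J 1 & forall x y, J (x * y) -> J x \/ J y].

Lemma idealMr J x y : ideal J -> J x -> J (x * y).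
Proof. by case=> _ _ JM Jx; rewrite mulrC; apply: JM. Qed.

Lemma idealN J x : ideal J -> J x -> J (- x).
Proof. by case=> _ _ JM Jx; rewrite -mulN1r; apply: JM. Qed.

Lemma idealB J x y : ideal J -> J x -> J y -> J (x - y).
Proof. by move=> idJ Jx Jy; case: (idJ) => _ JD _; apply: JD => //; apply: idealN. Qed.

Lemma ideal_sum J (I : Type) (r : seq I) (F : I -> R) :
  ideal J -> (forall i, J (F i)) -> J (\sum_(i <- r) F i).
Proof. by case=> J0 JD _ JF; elim/big_ind: _. Qed.

Lemma prime_idealX J x k : prime_ideal J -> J (x ^+ k) -> J x.
Proof.
move=> [idJ J1 Jp]; elim: k => [|k IHk]; first by rewrite expr0.
by rewrite exprS => /Jp[].
Qed.

Lemma ideal_adjoin J x : ideal J -> ideal (fun z => exists u w, J w /\ z = u * x + w).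
Proof.
move=> [J0 JD JM]; split.
- by exists 0, 0; rewrite mul0r addr0.
- move=> _ _ [u [w [Jw ->]]] [v [z [Jz ->]]].
  by exists (u + v), (w + z); rewrite mulrDl addrACA; split => //; apply: JD.
- move=> y _ [u [w [Jw ->]]]; exists (y * u), (y * w).
  by rewrite mulrDr mulrA; split => //; apply: JM.
Qed.

(** Zorn gives an ideal M maximal among those containing [I] and avoiding [S]. If [x] and [y] lie
    outside M, both M + (x) and M + (y) meet [S]; the product of the two elements lies in [S] and in
    M + (xy), so [x * y] is outside M. *)
Lemma exists_prime_avoiding (I S : R -> Prop) :
  ideal I -> S 1 -> (forall x y, S x -> S y -> S (x * y)) ->
  (forall x, I x -> ~ S x) ->
  exists J, [/\ prime_ideal J, (forall x, I x -> J x) & (forall x, J x -> ~ S x)].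
Proof.
move=> idI S1 SM IS.
(* The empty set is admitted so that the empty chain has an upper bound. *)
pose good J := [/\ (forall x y, J x -> J y -> J (x + y)),
  (forall x y, J y -> J (x * y)), (forall x, J x -> ~ S x)
  & (forall x, J x -> forall y, I y -> J y)].
have goodI : good I by case: idI => I0 ID IM; split.
have [|M [[MD MM MS IM] Mmax]] := @classical_sets.Zorn_bigcup R good.
  move=> F FP Ftot; split.
  - move=> x y [X FX Xx] [Y FY Yy].
    have [XY|YX] := Ftot _ _ FX FY.
      by exists Y => //; have [YD _ _ _] := FP _ FY; apply: YD => //; apply: XY.
    by exists X => //; have [XD _ _ _] := FP _ FX; apply: XD => //; apply: YX.
  - by move=> x y [X FX Xy]; exists X => //; have [_ XM _ _] := FP _ FX; apply: XM.
  - by move=> x [X FX Xx]; have [_ _ XS _] := FP _ FX; apply: XS.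
  - move=> x [X FX Xx] y Iy; exists X => //.
    by have [_ _ _ IX] := FP _ FX; apply: (IX x).
(* If M missed an element of [I], the last clause of [good] would make M empty, hence strictly
   smaller than [I]. *)
have sIM x : I x -> M x.
  move=> Ix; apply: boolp.contrapT => nMx; apply: (Mmax I) => //; split.
    by move=> y /IM /(_ _ Ix).
  by move=> /(_ _ Ix).
have M0 : M 0 by apply: sIM; case: idI.
have idM : ideal M by [].
have hit x : ~ M x -> exists u w, M w /\ S (u * x + w).
  move=> nMx; apply: boolp.contrapT => noS.
  pose Mx z := exists u w, M w /\ z = u * x + w.
  have sMMx z : M z -> Mx z by move=> Mz; exists 0, z; rewrite mul0r add0r.
  have [Mx0 MxD MxM] : ideal Mx by apply: ideal_adjoin.
  apply: (Mmax Mx).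
    split=> [z /sMMx //|sMxM]; apply/nMx/sMxM.
    by exists 1, 0; rewrite mul1r addr0.
  split=> //.
  - by move=> z [u [w [Mw ->]]] Sz; apply: noS; exists u, w.
  - by move=> _ _ y /sIM /sMMx.
exists M; split=> //; split=> // [M1|x y Mxy]; first exact: (MS 1).
apply: boolp.contrapT => nMxy.
have [|u [w [Mw Sx]]] := hit x; first by move=> Mx; apply: nMxy; left.
have [|v [z [Mz Sy]]] := hit y; first by move=> My; apply: nMxy; right.
apply: MS (SM _ _ Sx Sy); rewrite mulrDl mulrDr.
apply: (MD); last exact: idealMr.
by apply: (MD); [rewrite mulrACA; apply: (MM) | apply: (MM)].
Qed.

End Ideals.

Lemma prime_ideal_preim (R S : comNzRingType) (f : {rmorphism R -> S})
    (J : S -> Prop) :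
  prime_ideal J -> prime_ideal (fun x => J (f x)).
Proof.
move=> [[J0 JD JM] J1 Jp]; split; [split| |].
- by rewrite rmorph0.
- by move=> x y Jx Jy; rewrite rmorphD; apply: JD.
- by move=> x y Jy; rewrite rmorphM; apply: JM.
- by rewrite rmorph1.
- by move=> x y; rewrite rmorphM; apply: Jp.
Qed.

Lemma exists_min_size (R : nzRingType) (Q : {poly R} -> Prop) :
  (exists f, Q f) -> exists2 f, Q f & forall g, Q g -> (size f <= size g)%N.
Proof.
move=> [f0 Qf0]; pose p n := boolp.asbool (exists2 f, Q f & size f = n).
have exp : exists n, p n by exists (size f0); apply/boolp.asboolP; exists f0.
case: (ex_minnP exp) => m /boolp.asboolP[f Qf <-] fmin; exists f => // g Qg.
by apply: fmin; apply/boolp.asboolP; exists g.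
Qed.

Lemma poly_lead_term (R : nzRingType) (f : {poly R}) : f != 0 ->
  exists2 g : {poly R}, (size g < size f)%N & f = g + lead_coef f *: 'X^((size f).-1).
Proof.
move=> f0; have sf : (0 < size f)%N by rewrite size_poly_gt0.
exists (take_poly (size f).-1 f).
  by rewrite -[X in (_ < X)%N](prednK sf) ltnS size_take_poly.
rewrite -[LHS](poly_take_drop (size f).-1); congr (_ + _).
rewrite -mul_polyC; congr (_ * _); apply/polyP=> i.
rewrite coef_drop_poly coefC lead_coefE; case: i => [|i] //=.
by rewrite nth_default // addSn -{1}(prednK sf) ltnS leq_addl.
Qed.

(** * Primes of a univariate polynomial ring and extension of morphisms *)

Section PrimeOfPoly.

Variables (B : idomainType) (P : {poly B} -> Prop).
Hypothesis prP : prime_ideal P.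

Lemma prime_poly_coefs (F : {poly B}) : (forall i, P (F`_i)%:P) -> P F.
Proof.
case: prP => idP _ _ PF; rewrite -[F]coefK poly_def; apply: ideal_sum => // i.
by rewrite -mul_polyC; apply: idealMr.
Qed.

Lemma prime_polyC_expM (a : B) k (F : {poly B}) :
  ~ P a%:P -> P (a ^+ k *: F) -> P F.
Proof.
move=> nPa; case: prP => _ _ Pp; rewrite -mul_polyC => /Pp[] //.
by rewrite polyC_exp => /(prime_idealX prP).
Qed.

(* [f] plays the role of a minimal polynomial of [Y] over the fraction field of
   [B / (P \cap B)]. *)
Lemma prime_poly_minimal :
  (exists f, P f /\ exists i, ~ P (f`_i)%:P) ->
  exists f, [/\ P f, ~ P (lead_coef f)%:P, (1 < size f)%N
    & forall g, P g -> (size g < size f)%N -> forall i, P (g`_i)%:P].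
Proof.
case: (prP) => idP _ _ /exists_min_size[f [Pf [i nPfi]] fmin].
have small g : P g -> (size g < size f)%N -> forall i, P (g`_i)%:P.
  move=> Pg lt_gf j; apply: boolp.contrapT => nPgj.
  by have := fmin g (conj Pg (ex_intro _ j nPgj)); rewrite leqNgt lt_gf.
have P0 : P 0 by case: idP.
(* Otherwise dropping the leading term leaves a smaller element of [P], and all coefficients of [f]
   would lie in [P]. *)
have nPlead : ~ P (lead_coef f)%:P.
  move=> Pl; have f0 : f != 0 by apply: contra_notN nPfi => /eqP->; rewrite coef0.
  have [g lt_gf Df] := poly_lead_term f0.
  have Pt : P (lead_coef f *: 'X^((size f).-1)).
    by rewrite -mul_polyC; apply: idealMr.
  have Pg : P g.
    by rewrite -[g](addrK (lead_coef f *: 'X^((size f).-1))) -Df; apply: idealB.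
  apply: nPfi; rewrite Df coefD polyCD; case: (idP) => _ PD _; apply: PD.
    exact: small.
  by rewrite coefZ polyCM; apply: idealMr.
exists f; split=> //; rewrite ltnNge; apply/negP => /size1_polyC Df.
by apply: nPlead; rewrite lead_coefE Df size_polyC; case: eqP => [->|_];
  rewrite -?Df // coef0.
Qed.

(** Over the fraction field of B / (P ∩ B), [b] is invertible modulo the minimal polynomial [f];
    clearing denominators gives [r]. It is obtained as an element [g] of least size in P + (b)
    outside [P], which turns out to be constant. *)
Lemma prime_poly_elimination (f b : {poly B}) :
  P f -> ~ P (lead_coef f)%:P ->
  (forall g, P g -> (size g < size f)%N -> forall i, P (g`_i)%:P) ->
  ~ P b -> exists r, ~ P r%:P /\ exists u w, P w /\ r%:P = u * b + w.
Proof.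
case: (prP) => idP P1 Pp Pf nPa fmin nPb.
have [P0 PD PM] := idP.
pose J z := exists u w, P w /\ z = u * b + w.
have idJ : ideal J by apply: ideal_adjoin.
have [J0 JD JM] := idJ.
have sPJ z : P z -> J z by move=> Pz; exists 0, z; rewrite mul0r add0r.
have [|g [nPg Jg] gmin] := @exists_min_size _ (fun g => ~ P g /\ J g).
  by exists b; split=> //; exists 1, 0; rewrite mul1r addr0.
have small z : J z -> (size z < size g)%N -> P z.
  move=> Jz lt_zg; apply: boolp.contrapT => nPz.
  by have := gmin z (conj nPz Jz); rewrite leqNgt lt_zg.
have g0 : g != 0 by apply: contra_notN nPg => /eqP->.
have f0 : f != 0 by apply: contra_notN nPa => /eqP->; rewrite lead_coef0.
have nPl : ~ P (lead_coef g)%:P.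
  move=> Pl; have [h lt_hg Dg] := poly_lead_term g0.
  have Pt : P (lead_coef g *: 'X^((size g).-1)).
    by rewrite -mul_polyC; apply: idealMr.
  apply: nPg; rewrite Dg; apply: PD => //; apply: small => //.
  rewrite -[h](addrK (lead_coef g *: 'X^((size g).-1))) -Dg.
  by apply: idealB => //; apply: sPJ.
have [sg|sg] := leqP (size g) 1.
  have Dg := size1_polyC sg; exists g`_0; split; first by rewrite -Dg.
  by case: Jg => u [w [Pw Dg']]; exists u, w; rewrite -Dg.
(* Otherwise pseudo-division of [g] by [f] leaves a remainder smaller than [g] in [J], hence in [P],
   which forces [g] into [P]. *)
have lt_gf : (size g < size f)%N.
  rewrite ltnNge; apply/negP => le_fg; apply: nPg.
  apply: (@prime_polyC_expM (lead_coef f) (scalp g f)) => //.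
  rewrite Pdiv.Idomain.divp_eq; apply: (PD); first exact: PM.
  apply: small; last by apply: leq_trans le_fg; rewrite ltn_modp.
  have -> : g %% f = lead_coef f ^+ scalp g f *: g - g %/ f * f.
    by rewrite Pdiv.Idomain.divp_eq addrAC subrr add0r.
  by apply: idealB => //; [rewrite -mul_polyC; apply: JM | apply/sPJ/PM].
(* For [g] nonconstant, pseudo-divide [f] by [g]: the remainder is in [P] by minimality of [g],
   hence so is the quotient, since [g] is outside [P]. *)
exfalso; set m := scalp f g.
have Df := Pdiv.Idomain.divp_eq f g; rewrite -/m in Df.
have Pmf : P (lead_coef g ^+ m *: f) by rewrite -mul_polyC; apply: PM.
have lt_rg : (size (f %% g)%R < size g)%N by rewrite ltn_modp.
have Pr : P (f %% g).
  apply: small => //.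
  have -> : f %% g = lead_coef g ^+ m *: f - f %/ g * g.
    by rewrite Df addrAC subrr add0r.
  by apply: idealB => //; [apply: sPJ | apply: JM].
have Pq : P (f %/ g).
  have : P (f %/ g * g).
    by rewrite -[_ * g](addrK (f %% g)) -Df; apply: idealB.
  by case/Pp.
have lt_qf : (size (f %/ g)%R < size f)%N.
  by rewrite size_divp // ltn_subrL -subn1 subn_gt0 sg size_poly_gt0.
have Pqc := fmin _ Pq lt_qf.
(* In the degree of [f] the right-hand side has a coefficient in [P], while the left-hand side has a
   product of elements outside [P]. *)
have := congr1 (fun h : {poly B} => h`_(size f).-1) Df.
rewrite coefZ coefD -lead_coefE (nth_default 0 (n := _.-1) (s := f %% g)); last first.
  by rewrite -ltnS prednK ?size_poly_gt0 //; apply: ltn_trans lt_gf.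
rewrite addr0 coefM => Dc.
have : P (lead_coef g ^+ m * lead_coef f)%:P.
  rewrite Dc rmorph_sum; apply: ideal_sum => // i.
  by rewrite /= polyCM; apply: idealMr.
by rewrite polyCM => /Pp[|//]; rewrite polyC_exp => /(prime_idealX prP).
Qed.

(** If some element of [P] has a coefficient outside [P], then Y is algebraic modulo [P] and must go
    to a root of the image of its minimal polynomial. Otherwise Y is transcendental and only has to
    avoid the roots of the image of [b]. *)
Lemma prime_poly_specialization (A : idomainType) (b : {poly B}) :
  alg_closed A -> ~ P b ->
  exists c : B, ~ P c%:P /\ forall h : {rmorphism B -> A},
    (forall x, P x%:P -> h x = 0) -> h c != 0 ->
    exists t, (forall F, P F -> (map_poly h F).[t] = 0)
           /\ (map_poly h b).[t] != 0.
Proof.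
move=> Acl nPb; case: (prP) => idP P1 Pp; have [P0 PD PM] := idP.
have h_coefs (h : {rmorphism B -> A}) (F : {poly B}) : (forall x, P x%:P -> h x = 0) ->
    (forall i, P (F`_i)%:P) -> map_poly h F = 0.
  by move=> hP PF; apply/polyP=> i; rewrite coef_map coef0 /= hP.
have [Pex|noP] := boolp.EM (exists f, P f /\ exists i, ~ P (f`_i)%:P).
  have [f [Pf nPa sf fmin]] := prime_poly_minimal Pex.
  have [r [nPr [u [w [Pw Dr]]]]] := prime_poly_elimination Pf nPa fmin nPb.
  (* The first factor preserves the degree of [f] under [h], so its image has a root; the second
     keeps [b] nonzero at that root. *)
  exists (lead_coef f * r); split; first by rewrite polyCM => /Pp[].
  move=> h hP; rewrite rmorphM mulf_eq0 negb_or => /andP[ha hr].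
  have [t rt] : exists t, root (map_poly h f) t.
    by apply: Acl; rewrite size_map_poly_id0.
  have kill F : P F -> (map_poly h F).[t] = 0.
    move=> PF; have DF := Pdiv.Idomain.divp_eq F f.
    have Pr' : P (F %% f).
      have -> : F %% f = lead_coef f ^+ scalp F f *: F - F %/ f * f.
        by rewrite DF addrAC subrr add0r.
      by apply: idealB => //; [rewrite -mul_polyC; apply: PM | apply: PM].
    have f0 : f != 0 by rewrite -size_poly_gt0 ltnW.
    have /(congr1 (fun q => (map_poly h q).[t])) := DF.
    rewrite rmorphD rmorphM map_polyZ /= (h_coefs h (F %% f)) //; last first.
      by apply: fmin => //; rewrite ltn_modp.
    rewrite addr0 hornerZ hornerM (rootP rt) mulr0 => /eqP.
    by rewrite mulf_eq0 rmorphXn expf_eq0 (negbTE ha) andbF => /eqP.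
  (* If [b] vanished at [t], so would [u * b + w], whose image is the constant [h r]. *)
  exists t; split=> //; apply: contraNneq hr => hb0.
  have /(congr1 (fun q => (map_poly h q).[t])) := Dr.
  by rewrite rmorphD rmorphM map_polyC hornerC hornerD hornerM hb0 mulr0 kill // addr0
    => /eqP.
have Pcoef F : P F -> forall i, P (F`_i)%:P.
  by move=> PF i; apply: boolp.contrapT => nPi;
    apply: noP; exists F; split=> //; exists i.
have [i nPbi] : exists i, ~ P (b`_i)%:P.
  by apply/boolp.existsNP => Pb; apply/nPb/prime_poly_coefs.
exists b`_i; split=> // h hP hbi.
have hb0 : map_poly h b != 0.
  by apply: contraNneq hbi => hb; rewrite -coef_map hb coef0.
(* A root of [1 + Y b] is not a root of [b]. *)
have [t rt] : exists t, root (1 + map_poly h b * 'X) t.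
  apply: Acl; rewrite addrC size_polyDl size_mulX // ?size_poly1 ltnS ?size_poly_gt0 //.
exists t; split=> [F PF|]; first by rewrite (h_coefs h F) ?horner0 //; apply: Pcoef.
apply/eqP => hbt; move/rootP: rt; rewrite hornerD hornerMX hbt mul0r addr0 hornerC.
by move/eqP; rewrite oner_eq0.
Qed.

End PrimeOfPoly.

(** * Splitting off one variable; points separating a prime from a polynomial *)

Lemma mpoly_rmorph_eq (n : nat) (R S : comNzRingType)
    (f g : {rmorphism {mpoly R[n]} -> S}) :
  (forall c, f c%:MP = g c%:MP) -> (forall i, f 'X_i = g 'X_i) -> f =1 g.
Proof.
move=> fgC fgX p; elim/mpolyind: p => [|c m p _ _ IHp]; first by rewrite !rmorph0.
rewrite !rmorphD IHp -mul_mpolyC !rmorphM fgC mpolyXE_id !rmorph_prod.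
by congr (_ * _ + _); apply: eq_bigr => i _; rewrite !rmorphXn fgX.
Qed.

Section MPoly.

Variables (n : nat) (R : comNzRingType).

(* Polynomials in [n.+1] variables as polynomials in the variable [ord0] over
   those in the other [n] variables, and back. *)
Definition mpoly_to_poly : {mpoly R[n.+1]} -> {poly {mpoly R[n]}} :=
  mmap (polyC \o @mpolyC n R)
    (fun i => oapp (fun j : 'I_n => ('X_j)%:P) 'X (unlift ord0 i)).

Definition poly_to_mpoly : {poly {mpoly R[n]}} -> {mpoly R[n.+1]} :=
  horner_eval 'X_ord0 \o
  map_poly (mmap (@mpolyC n.+1 R) (fun j : 'I_n => 'X_(lift ord0 j))).

Lemma mpoly_to_polyK : cancel mpoly_to_poly poly_to_mpoly.
Proof.
move=> p; apply: (mpoly_rmorph_eq (f := poly_to_mpoly \o mpoly_to_poly) (g := idfun)).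
  move=> c /=; rewrite /mpoly_to_poly mmapC /poly_to_mpoly /= map_polyC /=.
  by rewrite /horner_eval hornerC mmapC.
move=> i /=; rewrite /mpoly_to_poly mmapX mmap1U /poly_to_mpoly /= /horner_eval.
case: unliftP => [j ->|->] /=; last by rewrite map_polyX hornerX.
by rewrite map_polyC hornerC /= mmapX mmap1U.
Qed.

Lemma horner_mpoly_to_poly (a : 'I_n -> R) (t : R) p :
  (map_poly (meval a) (mpoly_to_poly p)).[t]
    = p.@[fun i => oapp a t (unlift ord0 i)].
Proof.
apply: (mpoly_rmorph_eq
  (f := horner_eval t \o (map_poly (meval a) \o mpoly_to_poly))
  (g := meval (fun i => oapp a t (unlift ord0 i)))) p.
  by move=> c /=; rewrite /mpoly_to_poly mmapC /= map_polyC
    /horner_eval hornerC /= !mevalC.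
move=> i /=; rewrite /mpoly_to_poly mmapX mmap1U /horner_eval mevalXU.
case: unliftP => [j _|_] /=; last by rewrite map_polyX hornerX.
by rewrite map_polyC hornerC /= mevalXU.
Qed.

End MPoly.

Lemma prime_ideal_point (A : idomainType) (n : nat) (J : {mpoly A[n]} -> Prop) b :
  is_field A -> alg_closed A -> prime_ideal J -> ~ J b ->
  exists a, (forall Q, J Q -> Q.@[a] = 0) /\ b.@[a] != 0.
Proof.
move=> Afield Acl; elim: n => [|n IHn] in J b *.
  (* Without variables, [J] is a proper ideal of the field [A], hence zero, and the empty point
     works. *)
  move=> [[J0 JD JM] J1 Jp] nJb; exists (fun=> 0); split=> [Q|]; last first.
    rewrite [b]nvar0_mpolyC mevalC; apply: contra_notN nJb => /eqP b0.
    by rewrite [b]nvar0_mpolyC b0.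
  rewrite [Q]nvar0_mpolyC mevalC => JQ; apply/eqP; apply: contra_notT J1 => Q0.
  by rewrite -[1]/(1%:MP) -(mulVr (Afield _ Q0)) mpolyCM; apply: JM.
move=> prJ nJb; pose P F := J (poly_to_mpoly F).
have prP : prime_ideal P by apply: prime_ideal_preim prJ.
have nPb : ~ P (mpoly_to_poly b) by rewrite /P mpoly_to_polyK.
have [c [nPc ext]] := prime_poly_specialization prP Acl nPb.
(* Evaluation at [a] kills the contraction of [P] but not [c], which is what [ext] asks of a
   morphism. *)
have [|a [aP ac]] := IHn (fun x => P x%:P) c _ nPc; first exact: prime_ideal_preim prP.
have [t [tP tb]] := ext (meval a) aP ac.
exists (fun i => oapp a t (unlift ord0 i)); split=> [Q JQ|].
  by rewrite -horner_mpoly_to_poly tP // /P mpoly_to_polyK.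
by rewrite -horner_mpoly_to_poly.
Qed.

(** * Comparison of the vanishing ideal, the radical and the T-radical *)

Section GenIdeal.

Variables (A : idomainType) (n : nat).
Implicit Types (s : seq {mpoly A[n]}) (P : {mpoly A[n]}).

Lemma gen_ideal_ideal s : ideal (gen_ideal s).
Proof.
split.
- by exists (fun=> 0); rewrite big1 // => i _; rewrite mul0r.
- move=> _ _ [c ->] [d ->]; exists (fun i => c i + d i).
  by rewrite -big_split; apply: eq_bigr => i _; rewrite mulrDl.
- move=> p _ [c ->]; exists (fun i => p * c i).
  by rewrite mulr_sumr; apply: eq_bigr => i _; rewrite mulrA.
Qed.

Lemma radical_vanishing s P :
  radical (gen_ideal s) P -> vanishing_ideal (zeroset (gen_ideal s)) P.
Proof.
move=> [k IPk] a /(_ _ IPk); rewrite rmorphXn => /eqP.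
by rewrite expf_eq0 => /andP[_ /eqP].
Qed.

Lemma radical_T_radical s P :
  radical (gen_ideal s) P -> T_radical (gen_ideal s) P.
Proof.
by move=> [k IPk] J idJ IJ [J1 Jp] _; apply: (@prime_idealX _ J P k); [|apply: IJ].
Qed.

(** The kernel of evaluation at a zero of the ideal is one of the primes intersected in the
    T-radical. *)
Lemma T_radical_vanishing s P :
  T_radical (gen_ideal s) P -> vanishing_ideal (zeroset (gen_ideal s)) P.
Proof.
move=> TP a Za; apply: (TP (fun Q => Q.@[a] = 0)).
- split=> [|p q p0 q0|p q q0]; first exact: meval0.
    by rewrite mevalD p0 q0 addr0.
  by rewrite mevalM q0 mulr0.
- exact: Za.
- split=> [|p q]; first by rewrite meval1; apply/eqP; rewrite oner_eq0.
  by move/eqP; rewrite mevalM mulf_eq0 => /orP[/eqP|/eqP]; [left|right].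
- by move=> c; rewrite mevalC.
Qed.

(** If no power of [P] lies in the ideal, some prime above it avoids all these powers; a point
    separating that prime from [P] is a zero of the ideal at which [P] does not vanish. *)
Lemma vanishing_radical s P : is_field A -> alg_closed A ->
  vanishing_ideal (zeroset (gen_ideal s)) P -> radical (gen_ideal s) P.
Proof.
move=> Afield Acl VP; apply: boolp.contrapT => nRP.
have [||||J [prJ IJ JS]] :=
  @exists_prime_avoiding _ (gen_ideal s) (fun x => exists k, x = P ^+ k).
- exact: gen_ideal_ideal.
- by exists 0%N.
- by move=> _ _ [k ->] [l ->]; exists (k + l)%N; rewrite exprD.
- by move=> x Ix [k Dx]; apply: nRP; exists k; rewrite -Dx.
have [|a [aJ aP]] := prime_ideal_point (b := P) Afield Acl prJ.
  by move=> /JS; apply; exists 1%N.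
by move: aP; rewrite VP ?eqxx // => Q /IJ /aJ.
Qed.

End GenIdeal.

(** A root of [x *: 'X - 1] is an inverse of [x]. *)
Lemma alg_closed_field (A : idomainType) : alg_closed A -> is_field A.
Proof.
move=> Acl x x0; have [|y] := Acl (x *: 'X - 1).
  by rewrite size_polyDl ?size_polyN ?size_poly1 size_scale // size_polyX.
rewrite /root !hornerE subr_eq0 => /eqP xy; apply/unitrP; exists y.
by rewrite mulrC xy.
Qed.

(** * The converse, from ideals generated by one polynomial in one variable *)

Section Univariate.

Variable A : idomainType.
Implicit Type p : {poly A}.

Definition mpoly_of_poly p : {mpoly A[1]} := (map_poly (@mpolyC 1 A) p).['X_ord0].

Lemma rmorph_mpoly_of_poly (S : comNzRingType) (f : {rmorphism {mpoly A[1]} -> S}) p :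
  f (mpoly_of_poly p) = (map_poly (f \o @mpolyC 1 A) p).[f 'X_ord0].
Proof. by rewrite -horner_map map_poly_comp. Qed.

Lemma meval_mpoly_of_poly p (a : 'I_1 -> A) : (mpoly_of_poly p).@[a] = p.[a ord0].
Proof.
rewrite (rmorph_mpoly_of_poly (meval a)) /= mevalXU; congr (_.[_]).
by apply: map_poly_id => c _ /=; rewrite mevalC.
Qed.

Lemma constant_notin_gen_ideal p (c : A) : (1 < size p)%N ->
  gen_ideal [:: mpoly_of_poly p] c%:MP -> c = 0.
Proof.
move=> sp [d]; rewrite big_ord1 /=.
(* [f] carries the identity back to [{poly A}], where a nonzero multiple of [p] has at least the
   size of [p]. *)
pose f : {rmorphism {mpoly A[1]} -> {poly A}} :=
  mmap polyC (fun _ : 'I_1 => 'X : {poly A}).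
have fC x : f x%:MP = x%:P by rewrite /f /= mmapC.
move=> /(congr1 f); rewrite rmorphM rmorph_mpoly_of_poly fC.
have -> : f 'X_ord0 = 'X by rewrite /f /= mmapX mmap1U.
rewrite (eq_map_poly (g := polyC)) //.
have -> : (map_poly polyC p).['X] = p by rewrite -[RHS]comp_polyXr.
move=> Dc; apply/eqP; apply/negPn/negP => c0.
have /(congr1 (size \o polyseq)) := Dc; rewrite /= size_polyC c0 => Ds.
have : f (d ord0) * p != 0 by rewrite -Dc polyC_eq0.
rewrite mulf_eq0 negb_or -size_poly_gt0 => /andP[sd p0].
move: Ds; rewrite size_mul // -?size_poly_gt0 //.
by case: (size p) sp sd => [|[|m]] // _;
  case: (size _) => [|k] // _; rewrite addSnnS !addnS.
Qed.

Lemma vanishing_rootless p : ~ (exists x, root p x) ->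
  vanishing_ideal (zeroset (gen_ideal [:: mpoly_of_poly p])) 1.
Proof.
move=> noroot a Za; case: noroot; exists (a ord0).
rewrite /root -meval_mpoly_of_poly Za //.
by exists (fun=> 1); rewrite big_ord1 mul1r.
Qed.

Lemma alg_closed_of_radical :
  (forall (s : seq {mpoly A[1]}) P,
     vanishing_ideal (zeroset (gen_ideal s)) P -> radical (gen_ideal s) P) ->
  alg_closed A.
Proof.
move=> radI p sp; apply: boolp.contrapT => /vanishing_rootless/radI[k].
rewrite expr1n -[1]/(1%:MP) => /(constant_notin_gen_ideal sp)/eqP.
by rewrite oner_eq0.
Qed.

Lemma alg_closed_of_T_radical :
  (forall (s : seq {mpoly A[1]}) P,
     vanishing_ideal (zeroset (gen_ideal s)) P -> T_radical (gen_ideal s) P) ->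
  alg_closed A.
Proof.
move=> radI p sp; apply: boolp.contrapT => /vanishing_rootless/radI TI.
(* An ideal avoids [S] exactly when it meets [A] in 0, so the prime [J] below enters the T-radical
   and would have to contain 1. *)
pose S (x : {mpoly A[1]}) := exists2 c : A, c != 0 & x = c%:MP.
have [||||J [[idJ J1 Jp] IJ JS]] :=
  @exists_prime_avoiding _ (gen_ideal [:: mpoly_of_poly p]) S.
- exact: gen_ideal_ideal.
- by exists 1; rewrite ?oner_eq0.
- move=> _ _ [c c0 ->] [d d0 ->].
  by exists (c * d); rewrite ?mpolyCM // mulf_eq0 negb_or c0.
- move=> x Ix [c c0 Dx]; move: Ix c0; rewrite Dx.
  by move=> /(constant_notin_gen_ideal sp)->; rewrite eqxx.
apply: (J1); apply: (TI J idJ IJ (conj J1 Jp)) => c Jc; apply/eqP/negPn/negP => c0.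
by apply: JS Jc _; exists c.
Qed.

End Univariate.

Theorem theorem4p1 (A : idomainType) :
  ((is_field A /\ alg_closed A) <->
   (forall (n : nat) (s : seq {mpoly A[n]}) (P : {mpoly A[n]}),
      vanishing_ideal (zeroset (gen_ideal s)) P <-> radical (gen_ideal s) P))
  /\
  ((forall (n : nat) (s : seq {mpoly A[n]}) (P : {mpoly A[n]}),
      vanishing_ideal (zeroset (gen_ideal s)) P <-> radical (gen_ideal s) P) <->
   (forall (n : nat) (s : seq {mpoly A[n]}) (P : {mpoly A[n]}),
      vanishing_ideal (zeroset (gen_ideal s)) P <-> T_radical (gen_ideal s) P)).
Proof.
have acl_rad : alg_closed A -> forall n (s : seq {mpoly A[n]}) P,
    vanishing_ideal (zeroset (gen_ideal s)) P <-> radical (gen_ideal s) P.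
  move=> Acl n s P; split; last exact: radical_vanishing.
  exact: vanishing_radical (alg_closed_field Acl) Acl.
split; split.
- by case=> _; apply: acl_rad.
- move=> H; have Acl : alg_closed A by apply: alg_closed_of_radical => s P /H.
  by split=> //; apply: alg_closed_field.
- move=> H n s P; split; last exact: T_radical_vanishing.
  by move=> /H; apply: radical_T_radical.
(* The way from (3) to (2) passes through (1). *)
- by move=> H; apply/acl_rad/alg_closed_of_T_radical => s P /H.
Qed.
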